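(* Let $(X,*,\circ)$ be a finite skew brace. For an oriented classical or virtual link diagram $D$, let $\mathcal{C}(D,X)$ be the set of $X$-colorings of $D$, and define the polynomials $$\Phi_X^{SB}(D)=\sum_{f\in\mathcal{C}(D,X)} u^{\left|\overline{\mathrm{Im}(f)^{\circ}}\right|}\,v^{\left|\overline{\mathrm{Im}(f)^{*}}\right|}\in\mathbb{Z}[u,v] \qquad\text{and}\qquad \Phi_X^{I}(D)=\sum_{f\in\mathcal{C}(D,X)} u^{\left|I(\mathrm{Im}(f))\right|}\in\mathbb{Z}[u].$$ Then $\Phi_X^{SB}$ and $\Phi_X^{I}$ are invariants of oriented classical and virtual knots and links: if $D$ and $D'$ are two diagrams representing the same oriented classical or virtual knot or link, i.e. related by a finite sequence of planar isotopies and oriented classical and virtual Reidemeister moves, then $\Phi_X^{SB}(D)=\Phi_X^{SB}(D')$ and $\Phi_X^{I}(D)=\Phi_X^{I}(D')$.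
   Context: A skew brace is a set $X$ with two group operations $\circ$ and $*$, with inverses of $x$ denoted $x^{\circ}$ and $x^{*}$ respectively, satisfying $$x\circ(y*z)=(x\circ y)*(x^{*})*(x\circ z)\quad\text{for all }x,y,z\in X.$$ Associated to a skew brace are the two binary operations $$x\,\underline{\triangleright}\,y=y^{\circ}\circ(x*y),\qquad x\,\overline{\triangleright}\,y=y^{\circ}\circ(y*x),$$ which make $X$ a biquandle. That is: (i) $x\,\underline{\triangleright}\,x=x\,\overline{\triangleright}\,x$ for all $x$; (ii) the maps $x\mapsto x\,\underline{\triangleright}\,y$ and $x\mapsto x\,\overline{\triangleright}\,y$ are bijections for every $y$, and $S(x,y)=(y\,\overline{\triangleright}\,x,\;x\,\underline{\triangleright}\,y)$ is a bijection of $X\times X$; (iii) for all $x,y,z$ the exchange laws hold: $(x\underline{\triangleright}y)\underline{\triangleright}(z\underline{\triangleright}y)=(x\underline{\triangleright}z)\underline{\triangleright}(y\overline{\triangleright}z)$, $(x\underline{\triangleright}y)\overline{\triangleright}(z\underline{\triangleright}y)=(x\overline{\triangleright}z)\underline{\triangleright}(y\overline{\triangleright}z)$, $(x\overline{\triangleright}y)\overline{\triangleright}(z\overline{\triangleright}y)=(x\overline{\triangleright}z)\overline{\triangleright}(y\underline{\triangleright}z)$. Colorings. Diagrams are (nonempty) oriented virtual link diagrams, with classical and virtual crossings; a classical diagram is one without virtual crossings. A semiarc is a portion of the diagram running from one classical crossing passage (over or under) to the next, passing through virtual crossings without change; a component without classical crossings is a single semiarc. A skew brace coloring, or $X$-coloring,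 of $D$ is an assignment $f$ of an element of $X$ to each semiarc (so colors do not change at virtual crossings) which is a biquandle coloring by the associated biquandle, i.e. at each classical crossing: - Positive crossing: if the incoming under-semiarc is colored $x$ and the outgoing over-semiarc is colored $y$, then the outgoing under-semiarc is colored $x\,\underline{\triangleright}\,y$ and the incoming over-semiarc is colored $y\,\overline{\triangleright}\,x$. - Negative crossing: if the outgoing under-semiarc is colored $x$ and the incoming over-semiarc is colored $y$, then the incoming under-semiarc is colored $x\,\underline{\triangleright}\,y$ and the outgoing over-semiarc is colored $y\,\overline{\triangleright}\,x$. Image and closures. For $f\in\mathcal{C}(D,X)$, $\mathrm{Im}(f)$ is the biquandle closure of the set of colors used by $f$: the smallest subset of $X$ containing these colors and closed under $\underline{\triangleright}$, $\overline{\triangleright}$ and their right inverse operations. For $S\subset X$, $\overline{S^{\circ}}$ and $\overline{S^{*}}$ denote the subgroups generated by $S$ in the groups $(X,\circ)$ and $(X,* )$ respectively. Ideals. A subset $I\subset X$ is an ideal if for all $x,y\in I$ and $z\in X$ the elements $y^{\circ}\circ x$, $z^{*}*x*z$, $z^{\circ}\circ x\circ z$ and $z^{*}*(z\circ x)$ are in $I$. For a subset $S\subset X$, $I(S)$ denotes the ideal generated by $S$, i.e. the smallest ideal of $X$ containing $S$. *)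

(* Defs.v *)
From HB Require Import structures.
From Stdlib Require Export Relation_Operators.
From mathcomp Require Export all_boot all_order all_fingroup all_algebra.
From mathcomp Require Export mpoly.

Set Implicit Arguments.
Unset Strict Implicit.
Unset Printing Implicit Defensive.

Import GRing.Theory.

(** * Finite skew braces *)

(* [star] is the operation $*$ (the additive group) and [circ] is $\circ$;
   [sinv] and [cinv] are the respective inverses.  The two units are not
   assumed equal: this follows from [braceP]. *)
Record finSkewBrace := FinSkewBrace {
  carrier :> finType;
  star : carrier -> carrier -> carrier;
  sone : carrier;
  sinv : carrier -> carrier;
  circ : carrier -> carrier -> carrier;
  cone : carrier;
  cinv : carrier -> carrier;
  starA : associative star;
  star1l : left_id sone star;
  starVl : left_inverse sone sinv star;
  circA : associative circ;
  circ1l : left_id cone circ;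
  circVl : left_inverse cone cinv circ;
  braceP : forall x y z : carrier,
    circ x (star y z) = star (star (circ x y) (sinv x)) (circ x z)
}.

(* Copies of the carrier of X, bearing one group structure each. *)
Definition starG (X : finSkewBrace) : Type := X.
HB.instance Definition _ (X : finSkewBrace) := Finite.on (starG X).
HB.instance Definition _ (X : finSkewBrace) :=
  Finite_isGroup.Build (starG X) (@starA X) (@star1l X) (@starVl X).

Definition circG (X : finSkewBrace) : Type := X.
HB.instance Definition _ (X : finSkewBrace) := Finite.on (circG X).
HB.instance Definition _ (X : finSkewBrace) :=
  Finite_isGroup.Build (circG X) (@circA X) (@circ1l X) (@circVl X).

Definition star_gen (X : finSkewBrace) (S : {set X}) : {set starG X} :=
  <<[set x : starG X | (x : X) \in S]>>%g.
Definition circ_gen (X : finSkewBrace) (S : {set X}) : {set circG X} :=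
  <<[set x : circG X | (x : X) \in S]>>%g.

(* Every predicate P to which this is applied is stable under arbitrary
   intersections, so that this is the smallest P-set containing S. *)
Definition smallest (T : finType) (P : pred {set T}) (S : {set T}) : {set T} :=
  \bigcap_(A : {set T} | P A && (S \subset A)) A.

Definition ideal (X : finSkewBrace) (I : {set X}) : bool :=
  [forall x in I, forall y in I, circ (cinv y) x \in I] &&
  [forall x in I, forall z : X,
     [&& star (star (sinv z) x) z \in I,
         circ (circ (cinv z) x) z \in I &
         star (sinv z) (circ z x) \in I]].

Definition ideal_gen (X : finSkewBrace) (S : {set X}) : {set X} :=
  smallest (@ideal X) S.

(** * The associated biquandle *)

Definition utri (X : finSkewBrace) (x y : X) : X := circ (cinv y) (star x y).
Definition otri (X : finSkewBrace) (x y : X) : X := circ (cinv y) (star y x).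

(* The maps utri^~ y and otri^~ y are bijective; the last two clauses say that
   A is closed under their inverses. *)
Definition biq_closed (X : finSkewBrace) (A : {set X}) : bool :=
  [forall y in A, forall x : X,
     [&& (x \in A) ==> (utri x y \in A),
         (x \in A) ==> (otri x y \in A),
         (utri x y \in A) ==> (x \in A) &
         (otri x y \in A) ==> (x \in A)]].

Definition biq_closure (X : finSkewBrace) (S : {set X}) : {set X} :=
  smallest (@biq_closed X) S.

(** * Oriented virtual link diagrams

   A diagram is a plane diagram in general position with respect to the height
   function, read from bottom to top and cut by horizontal lines into slices,
   each of which contains exactly one local minimum, local maximum, classical
   crossing or virtual crossing, all other strands being monotone.  A
   horizontal line, [level], is recorded as the list, from left to right, of
   the orientations of the strands it meets: [true] is upwards. *)

Definition level := seq bool.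

(* [Classical true]: the strand joining the bottom left corner of the crossing
   to the top right one is the overstrand; [Classical false]: it is the
   understrand. *)
Inductive crossing := Virtual | Classical of bool.

(* [Cup o] is a local minimum and [Cap o] a local maximum; o is the orientation
   of the left leg.  In [Cross k a b], a is the orientation of the strand
   joining the bottom left to the top right corner, b that of the strand joining
   the bottom right to the top left corner. *)
Inductive event :=
  | Cup of bool
  | Cap of bool
  | Cross of crossing & bool & bool.

Definition bot (e : event) : level :=
  match e with
  | Cup _ => [::]
  | Cap o => [:: o; ~~ o]
  | Cross _ a b => [:: a; b]
  end.

Definition top (e : event) : level :=
  match e with
  | Cup o => [:: o; ~~ o]
  | Cap _ => [::]
  | Cross _ a b => [:: b; a]
  end.

Record slice := Slice { sleft : level; sevent : event; sright : level }.

Definition sbot (s : slice) : level := sleft s ++ bot (sevent s) ++ sright s.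
Definition stop (s : slice) : level := sleft s ++ top (sevent s) ++ sright s.

Fixpoint composable (l : level) (w : seq slice) (l' : level) : bool :=
  if w is s :: w' then (sbot s == l) && composable (stop s) w' l' else l == l'.

(* Nonempty diagrams only. *)
Record diagram := Diagram {
  slices :> seq slice;
  diagramP : ~~ nilp slices && composable [::] slices [::]
}.

(** * Planar isotopy and Reidemeister moves *)

Definition whisker (l r : level) (w : seq slice) : seq slice :=
  [seq Slice (l ++ sleft s) (sevent s) (sright s ++ r) | s <- w].

(* When the two strands of a crossing trade the bottom left and bottom right
   corners, the overstrand remaining the same strand, b changes. *)
Definition mirror (k : crossing) : crossing :=
  if k is Classical b then Classical (~~ b) else Virtual.

(* The moves generating planar isotopy: exchange of the heights of two distant
   events; birth or death of a pair of consecutive extrema on a strand; passage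
   of a crossing through a local maximum or minimum of one of its strands. *)
Inductive planar_move : seq slice -> seq slice -> Prop :=
  | Exchange e1 (m : level) e2 : planar_move
      [:: Slice [::] e1 (m ++ bot e2); Slice (top e1 ++ m) e2 [::]]
      [:: Slice (bot e1 ++ m) e2 [::]; Slice [::] e1 (m ++ top e2)]
  | ZigzagR o : planar_move
      [:: Slice [:: o] (Cup (~~ o)) [::]; Slice [::] (Cap o) [:: o]]
      [::]
  | ZigzagL o : planar_move
      [:: Slice [::] (Cup o) [:: o]; Slice [:: o] (Cap (~~ o)) [::]]
      [::]
  | SwingCap k o c : planar_move
      [:: Slice [:: o] (Cross k c (~~ o)) [::]; Slice [::] (Cap o) [:: c]]
      [:: Slice [::] (Cross (mirror k) o c) [:: ~~ o];
          Slice [:: c] (Cap o) [::]]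
  | SwingCup k o c : planar_move
      [:: Slice [::] (Cup o) [:: c]; Slice [:: o] (Cross k (~~ o) c) [::]]
      [:: Slice [:: c] (Cup o) [::];
          Slice [::] (Cross (mirror k) c o) [:: ~~ o]].

(* The crossings allowed in a third move, between the first and second, first
   and third, second and third strands.  Either all are classical and one of
   the strands lies above and another below the two others, or all are virtual,
   or exactly two are virtual (one strand then crosses the others virtually). *)
Definition third_move_ok (k12 k13 k23 : crossing) : bool :=
  match k12, k13, k23 with
  | Classical b12, Classical b13, Classical b23 => (b13 == b12) || (b13 == b23)
  | Virtual, Virtual, _ | Virtual, _, Virtual | _, Virtual, Virtual => true
  | _, _, _ => false
  end.

(* Each constructor covers all orientations of the strands, and both the
   classical and the virtual versions of the move. *)
Inductive reidemeister_move : seq slice -> seq slice -> Prop :=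
  | FirstR k o : reidemeister_move
      [:: Slice [:: o] (Cup o) [::];
          Slice [::] (Cross k o o) [:: ~~ o];
          Slice [:: o] (Cap o) [::]]
      [::]
  | FirstL k o : reidemeister_move
      [:: Slice [::] (Cup (~~ o)) [:: o];
          Slice [:: ~~ o] (Cross k o o) [::];
          Slice [::] (Cap (~~ o)) [:: o]]
      [::]
  | Second k a b : reidemeister_move
      [:: Slice [::] (Cross k a b) [::];
          Slice [::] (Cross (mirror k) b a) [::]]
      [::]
  | Third k12 k13 k23 a b c : third_move_ok k12 k13 k23 ->
      reidemeister_move
      [:: Slice [::] (Cross k12 a b) [:: c];
          Slice [:: b] (Cross k13 a c) [::];
          Slice [::] (Cross k23 b c) [:: a]]
      [:: Slice [:: a] (Cross k23 b c) [::];
          Slice [::] (Cross k13 a c) [:: b];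
          Slice [:: c] (Cross k12 a b) [::]].

(* When the right-hand side is [::], composability of D forces the level where
   the move takes place to be the bottom of the left-hand side. *)
Definition move (D D' : diagram) : Prop :=
  exists (below above : seq slice) (l r : level) (w w' : seq slice),
    [/\ planar_move w w' \/ reidemeister_move w w',
        slices D = below ++ whisker l r w ++ above &
        slices D' = below ++ whisker l r w' ++ above].

Definition same_link : diagram -> diagram -> Prop :=
  clos_refl_sym_trans diagram move.

(** * Semiarcs *)

(* The point (i, j) is the j-th intersection, from the left, of the diagram with
   the i-th horizontal line, from the bottom; the slice number i lies between
   the lines i and i.+1. *)
Definition levels (w : seq slice) : seq level := [::] :: map stop w.

Definition points (w : seq slice) : seq (nat * nat) :=
  [seq (i, j) | i <- iota 0 (size (levels w)),
                j <- iota 0 (size (nth [::] (levels w) i))].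

(* The pairs of points that are the end points of a strand of slice number i,
   other than the two strands of a classical crossing. *)
Definition slice_strands (i : nat) (s : slice) :
    seq ((nat * nat) * (nat * nat)) :=
  let m := size (sleft s) in
  [seq ((i, j), (i.+1, j)) | j <- iota 0 m]
  ++ match sevent s with
     | Cup _ => [:: ((i.+1, m), (i.+1, m.+1))]
     | Cap _ => [:: ((i, m), (i, m.+1))]
     | Cross Virtual _ _ =>
         [:: ((i, m), (i.+1, m.+1)); ((i, m.+1), (i.+1, m))]
     | Cross (Classical _) _ _ => [::]
     end
  ++ [seq ((i, m + size (bot (sevent s)) + j),
           (i.+1, m + size (top (sevent s)) + j))
        | j <- iota 0 (size (sright s))].

Fixpoint strands (i : nat) (w : seq slice) : seq ((nat * nat) * (nat * nat)) :=
  if w is s :: w' then slice_strands i s ++ strands i.+1 w' else [::].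

Definition point (D : diagram) := seq_sub (points D).

Definition joined (D : diagram) : rel (point D) :=
  [rel p q | ((val p, val q) \in strands 0 D)
          || ((val q, val p) \in strands 0 D)].

Definition semiarcs (D : diagram) : {set {set point D}} :=
  equivalence_partition (connect (@joined D)) [set: point D].

Definition semiarc (D : diagram) := {A : {set point D} | A \in semiarcs D}.

(** * Colorings *)

(* A classical crossing: whether it is positive, and points on its incoming and
   outgoing under-semiarcs and its incoming and outgoing over-semiarcs. *)
Record crossing_data := CrossingData {
  positive : bool;
  under_in : nat * nat;
  under_out : nat * nat;
  over_in : nat * nat;
  over_out : nat * nat
}.

(* For upward strands, the crossing is positive when the overstrand goes from
   the bottom left to the top right; reversing one strand changes the sign. *)
Definition slice_crossings (i : nat) (s : slice) : seq crossing_data :=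
  if sevent s is Cross (Classical o) a b then
    let m := size (sleft s) in
    let bl := (i, m) in let br := (i, m.+1) in
    let tl := (i.+1, m) in let tr := (i.+1, m.+1) in
    let: (in1, out1) := if a then (bl, tr) else (tr, bl) in
    let: (in2, out2) := if b then (br, tl) else (tl, br) in
    let sign := o == (a == b) in
    if o then [:: CrossingData sign in2 out2 in1 out1]
    else [:: CrossingData sign in1 out1 in2 out2]
  else [::].

Fixpoint crossings (i : nat) (w : seq slice) : seq crossing_data :=
  if w is s :: w' then slice_crossings i s ++ crossings i.+1 w' else [::].

(* The point p lies on the semiarc A. *)
Definition on_semiarc (D : diagram) (p : nat * nat) (A : semiarc D) : bool :=
  [exists q in val A, val q == p].

Definition crossing_rule (X : finSkewBrace) (D : diagram)
    (f : {ffun semiarc D -> X}) (c : crossing_data) : bool :=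
  [forall ui, forall uo, forall oi, forall oo : semiarc D,
    [&& on_semiarc (under_in c) ui, on_semiarc (under_out c) uo,
        on_semiarc (over_in c) oi & on_semiarc (over_out c) oo] ==>
    if positive c
    then (f uo == utri (f ui) (f oo)) && (f oi == otri (f oo) (f ui))
    else (f ui == utri (f uo) (f oi)) && (f oo == otri (f oi) (f uo))].

Definition is_coloring (X : finSkewBrace) (D : diagram)
    (f : {ffun semiarc D -> X}) : bool :=
  all (crossing_rule f) (crossings 0 D).

(* Im(f) *)
Definition image_closure (X : finSkewBrace) (D : diagram)
    (f : {ffun semiarc D -> X}) : {set X} :=
  biq_closure [set f A | A : semiarc D].

Definition colorings (X : finSkewBrace) (D : diagram) :
    {set {ffun semiarc D -> X}} :=
  [set f | is_coloring f].

(** * The polynomial invariants *)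

Local Open Scope ring_scope.

(* 'X_ord0 is u and 'X_ord_max is v. *)
Definition PhiSB (X : finSkewBrace) (D : diagram) : {mpoly int[2]} :=
  \sum_(f in colorings X D)
    'X_ord0 ^+ #|circ_gen (image_closure f)| *
    'X_ord_max ^+ #|star_gen (image_closure f)|.

Definition PhiI (X : finSkewBrace) (D : diagram) : {poly int} :=
  \sum_(f in colorings X D) 'X ^+ #|ideal_gen (image_closure f)|.

(* Main.v *)
From mathcomp Require Import zify.
Require Import Defs.

Set Implicit Arguments.
Unset Strict Implicit.
Unset Printing Implicit Defensive.

(** The invariants are state sums.  A coloring is the same thing as a sequence
   of rows of colors, one row for each horizontal line, such that consecutive
   rows satisfy the relation imposed by the slice between them
   ([is_coloringE], [trace_inj], [trace_onto]).  The sum over all these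
   sequences can be cut along any horizontal line, so it does not change under
   a local move whose two sides allow the same pairs (bottom row, top row),
   provided that each such pair comes from only one sequence of middle rows, and
   that the colors in the middle rows lie in the biquandle closure of those in
   the bottom and top rows ([state_sum_interchange]).  The second proviso makes
   Im(f) the same on both sides, hence also everything that is computed from
   Im(f): both polynomials are sums of a function of Im(f), and they are
   treated at once ([coloring_sum_invariant]).

   The moves are thus reduced to statements about the relation between the four
   colors at a crossing.  What makes them short is a change of variables: colors
   are put on the regions of the plane instead of the strands.  If g and h are
   the regions on the right and on the left of an oriented strand, its color is
   the quotient g^-1 h for the circle operation ([arc]).  By the skew brace
   identity x o (y * z) = (x o y) * x^-1 * (x o z), the rule at a crossing with
   regions W, S, E, N becomes S^-1 W = E^-1 N or E^-1 S = N^-1 W in the star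
   group, the first if the strand joining bottom left to top right is above, the
   second if it is below, whatever the orientations ([classical_regions]).  In
   words, the color of the region on the left of an overstrand is the color of
   the region on its right, multiplied by a constant.  Third moves for all
   orientations then follow from identities in a group, one pair for each order
   of heights of the three strands ([third_regions]). *)

(** * Group structures of a skew brace *)

Section Brace.
Variable X : finSkewBrace.
Implicit Types (x y z g h R U O L W S E N : X) (A : {set X}).

Lemma starKV x y : star (star y (sinv x)) x = y.
Proof. exact: (@mulgKV (starG X)). Qed.
Lemma starK x y : star (star y x) (sinv x) = y.
Proof. exact: (@mulgK (starG X)). Qed.
Lemma starVr x : star x (sinv x) = sone X.
Proof. exact: (@mulgV (starG X)). Qed.
Lemma sinvM x y : sinv (star x y) = star (sinv y) (sinv x).
Proof. exact: (@invMg (starG X)). Qed.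
Lemma sinvK x : sinv (sinv x) = x.
Proof. exact: (@invgK (starG X)). Qed.

Lemma circI x : injective (circ x).
Proof. exact: (@mulgI (circG X)). Qed.
Lemma circIr x : injective (fun y => circ y x).
Proof. exact: (@mulIg (circG X)). Qed.
Lemma circ1r x : circ x (cone X) = x.
Proof. exact: (@mulg1 (circG X)). Qed.
Lemma circKV x y : circ x (circ (cinv x) y) = y.
Proof. exact: (@mulKVg (circG X)). Qed.
Lemma circVK x y : circ (cinv x) (circ x y) = y.
Proof. exact: (@mulKg (circG X)). Qed.
Lemma cinvM x y : cinv (circ x y) = circ (cinv y) (cinv x).
Proof. exact: (@invMg (circG X)). Qed.
Lemma cinvK x : cinv (cinv x) = x.
Proof. exact: (@invgK (circG X)). Qed.

(** * Crossings and colors of regions *)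

(** The relation between the four semiarcs at a crossing.  In all cases x and x'
   lie on the understrand, y and y' on the overstrand, and x and y border the
   region that is on the right of both strands. *)
Definition biq_rel x y x' y' := (x' == utri x y) && (y' == otri y x).

(** The color of a vertical strand of orientation o with the region g on its
   right side and h on its left side, as seen on the page. *)
Definition arc (o : bool) g h :=
  if o then circ (cinv g) h else circ (cinv h) g.

(** The top region of a classical crossing, given the left, bottom and right
   ones; o tells whether the strand between the bottom left and the top right
   corner is above.  With its arguments permuted, the same function gives any of
   the four regions in terms of the three others. *)
Definition fourth (o : bool) W S E :=
  if o then star (star E (sinv S)) W else star (star W (sinv S)) E.

(** The skew brace identity: x o (y * z) with x = R, for two colors read off
   from the regions. *)
Lemma circ_star_arc R U O :
  star (circ (cinv R) U) (circ (cinv R) O)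
    = circ (cinv R) (fourth false U R O).
Proof. by apply: (@circI R); rewrite braceP !circKV. Qed.

(** The crossing rule in terms of the regions: R is on the right of both
   strands, U and O are reached from R by crossing the understrand and the
   overstrand, L is on the left of both.  Each of the next lemmas takes one
   color of each strand as known, thus three regions, and computes the other two
   colors. *)
Lemma biq_rel_xy R U O x' y' (L := fourth false U R O) :
  biq_rel (circ (cinv R) U) (circ (cinv R) O) x' y'
    = (x' == circ (cinv O) L) && (y' == circ (cinv U) L).
Proof.
by rewrite /biq_rel /utri /otri circ_star_arc !cinvM !cinvK -!circA !circKV.
Qed.

Lemma fourthK o W S E : fourth o S W (fourth o W S E) = E.
Proof.
case: o; rewrite /fourth; first by rewrite starK starKV.
by rewrite !starA starKV starVr star1l.
Qed.

Lemma biq_rel_xy' R U L y x' (O := fourth false R U L) :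
  biq_rel (circ (cinv R) U) y x' (circ (cinv U) L)
    = (y == circ (cinv R) O) && (x' == circ (cinv O) L).
Proof.
have eL : fourth false U R O = L by rewrite fourthK.
apply/idP/andP => [|[/eqP-> /eqP->]]; last by rewrite biq_rel_xy eL !eqxx.
rewrite -(circVK R y); set O1 := circ R y.
rewrite biq_rel_xy => /andP[/eqP-> /eqP/circI e].
by rewrite /O e fourthK !eqxx.
Qed.

Lemma biq_rel_x'y R O L x y' (U := fourth false L O R) :
  biq_rel x (circ (cinv R) O) (circ (cinv O) L) y'
    = (x == circ (cinv R) U) && (y' == circ (cinv U) L).
Proof.
have eL : fourth false U R O = L by rewrite /U /fourth starK starKV.
apply/idP/andP => [|[/eqP-> /eqP->]]; last by rewrite biq_rel_xy eL !eqxx.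
rewrite -(circVK R x); set U1 := circ R x.
rewrite biq_rel_xy => /andP[/eqP/circI e /eqP->].
by rewrite /U e /fourth starK starKV !eqxx.
Qed.

Lemma biq_rel_x'y' U O L x y (R := fourth false O L U) :
  biq_rel x y (circ (cinv O) L) (circ (cinv U) L)
    = (x == circ (cinv R) U) && (y == circ (cinv R) O).
Proof.
have eL : fourth false U R O = L.
  by rewrite /R /fourth !sinvM sinvK !starA starKV starVr star1l.
apply/idP/andP => [|[/eqP-> /eqP->]]; last by rewrite biq_rel_xy eL !eqxx.
have eR : x = circ (cinv (circ U (cinv x))) U.
  by rewrite cinvM cinvK -circA circVl circ1r.
rewrite {1 2}eR; set R1 := circ U (cinv x); rewrite -(circVK R1 y).
set O1 := circ R1 y.
rewrite biq_rel_xy => /andP[/eqP + /eqP/circI e]; rewrite -e.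
move=> /circIr/(can_inj cinvK) eO.
have -> : R = R1.
  by rewrite /R e eO /fourth !sinvM sinvK !starA starVr star1l starKV.
by rewrite eO !eqxx.
Qed.

(** Closure under the operations and their right inverses is enough unless the
   elements known to be in A are x' and y'.  In that case, the injective map
   sending (x, y) to (x', y') permutes the finite set A x A. *)
Lemma biq_rel_closed A x y x' y' :
  biq_closed A -> biq_rel x y x' y' ->
  (x \in A) || (x' \in A) -> (y \in A) || (y' \in A) ->
  [/\ x \in A, y \in A, x' \in A & y' \in A].
Proof.
move=> /forall_inP clA.
have cl u v : v \in A ->
    [/\ (utri u v \in A) = (u \in A) & (otri u v \in A) = (u \in A)].
  move=> /clA/forallP/(_ u)/and4P[c1 c2 c3 c4].
  by split; apply/idP/idP; apply/implyP.
have rel_inj u v u1 v1 p q :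
    biq_rel u v p q -> biq_rel u1 v1 p q -> (u, v) = (u1, v1).
  (* Any two colors p and q are read off from regions O, L, U with L = 1. *)
  have -> : q = circ (cinv (cinv q)) (cone X) by rewrite cinvK circ1r.
  have -> : p = circ (cinv (cinv p)) (cone X) by rewrite cinvK circ1r.
  by rewrite !biq_rel_x'y' => /andP[/eqP-> /eqP->] /andP[/eqP-> /eqP->].
move=> rel; case/andP: (rel) => /eqP ex' /eqP ey'.
case: (boolP (x \in A)) => xA; case: (boolP (y \in A)) => yA /=.
- move=> _ _; rewrite ex' ey'.
  by have [-> _] := cl x y yA; have [_ ->] := cl y x xA.
- by move=> _; rewrite ey'; have [_ ->] := cl y x xA; rewrite (negPf yA).
- by rewrite ex'; have [-> _] := cl x y yA; rewrite (negPf xA).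
move=> x'A y'A.
pose s (uv : X * X) := (utri uv.1 uv.2, otri uv.2 uv.1).
have s_inj : injective s.
  move=> [u v] [u1 v1] [/= e1 e2];
    apply: (rel_inj _ _ _ _ (utri u v) (otri v u)).
      by rewrite /biq_rel !eqxx.
    by rewrite /biq_rel e1 e2 !eqxx.
have sA : s @: setX A A = setX A A.
  apply/eqP; rewrite eqEcard card_imset // leqnn andbT.
  apply/subsetP => z /imsetP[[u v] + ->].
  rewrite !inE /= => /andP[uA vA].
  by have [-> _] := cl u v vA; have [_ ->] := cl v u uA; rewrite uA.
have : (x', y') \in setX A A by rewrite !inE x'A.
rewrite -sA => /imsetP[[u v]]; rewrite !inE /= => /andP[uA _] [eu ev].
have [xu _] : (x, y) = (u, v).
  by apply: rel_inj rel _; rewrite eu ev /biq_rel !eqxx.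
by rewrite xu uA in xA.
Qed.

(** The coloring rule at a classical crossing: bl, br, tl, tr are the colors at
   the bottom left, bottom right, top left and top right corners; o, a, b are
   the parameters of [Cross (Classical o) a b]. *)
Definition classical_rel (o a b : bool) bl br tl tr : bool :=
  let: (in1, out1) := if a then (bl, tr) else (tr, bl) in
  let: (in2, out2) := if b then (br, tl) else (tl, br) in
  let: (ui, uo, oi, oo) := if o then (in2, out2, in1, out1)
                           else (in1, out1, in2, out2) in
  if o == (a == b) then biq_rel ui oo uo oi else biq_rel uo oi ui oo.

(** The eight cases fall under the four lemmas above: the right region of both
   strands can be any of the four, depending on the orientations. *)
Lemma classical_regions o a b W S E tl tr (N := fourth o W S E) :
  classical_rel o a b (arc a S W) (arc b E S) tl tr
    = (tl == arc b N W) && (tr == arc a E N).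
Proof.
rewrite {}/N; move: o a b => [] [] [];
by rewrite /classical_rel /arc /= ?biq_rel_xy ?biq_rel_xy' ?biq_rel_x'y
     ?biq_rel_x'y' /fourth 1?andbC.
Qed.

Lemma classical_closed A o a b bl br tl tr :
  biq_closed A -> classical_rel o a b bl br tl tr ->
  (bl \in A) || (tr \in A) -> (br \in A) || (tl \in A) ->
  [/\ bl \in A, br \in A, tl \in A & tr \in A].
Proof.
move=> clA + h1 h2; have [h1' h2'] := conj h1 h2.
rewrite orbC in h1'; rewrite orbC in h2'.
have cl := biq_rel_closed clA.
by move: o a b => [] [] []; rewrite /classical_rel /= => rel;
  first [case: (cl _ _ _ _ rel h1 h2)  | case: (cl _ _ _ _ rel h1' h2')
       | case: (cl _ _ _ _ rel h2 h1)  | case: (cl _ _ _ _ rel h2' h1')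
       | case: (cl _ _ _ _ rel h1' h2) | case: (cl _ _ _ _ rel h1 h2')
       | case: (cl _ _ _ _ rel h2' h1) | case: (cl _ _ _ _ rel h2 h1')].
Qed.

(** The rule does not refer to the vertical direction: this is the invariance
   under a quarter turn. *)
Lemma classical_rot o a b bl br tl tr :
  classical_rel (~~ o) b (~~ a) br tr bl tl = classical_rel o a b bl br tl tr.
Proof. by move: o a b => [] [] []. Qed.

(** Undoing a crossing is a crossing of the opposite kind, which is the content
   of the second move. *)
Lemma classical_flip o a b bl br tl tr :
  classical_rel (~~ o) b a bl br tl tr = classical_rel o a b tl tr bl br.
Proof. by move: o a b => [] [] []. Qed.

(** Any row of colors of strands comes from colors of regions, and the leftmost
   of these can be chosen at will. *)
Lemma arc_right o h x : exists g, x = arc o g h.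
Proof.
case: o; rewrite /arc.
  by exists (circ h (cinv x)); rewrite cinvM cinvK -circA circVl circ1r.
by exists (circ h x); rewrite circVK.
Qed.

Lemma arc_inj o g : injective (arc o g).
Proof. by case: o => x y /= => [/circI|/circIr/(can_inj cinvK)]. Qed.

Lemma arc_injl o h : injective (fun g => arc o g h).
Proof. by case: o => x y /= => [/circIr/(can_inj cinvK)|/circI]. Qed.

(** In a kink the regions at the bottom and at the top are the same, since the
   strand closes up; the region inside the loop is then determined by the other
   two, and the color of the strand does not change. *)
Lemma classical_kink o a x :
  exists z0, forall z w, classical_rel o a a x z w z = (w == x) && (z == z0).
Proof.
have [g ->] := arc_right a (cone X) x.
exists (arc a (fourth o g (cone X) g) g) => z w.
have [m ->] := arc_right a g z.
rewrite classical_regions; apply/andP/andP => -[/eqP-> /eqP].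
  move=> /arc_inj e; rewrite -e; split=> //.
  by rewrite -{1}(fourthK o (cone X) g m) -e.
by move=> /arc_injl->; rewrite fourthK.
Qed.

Lemma classical_total o a b bl br :
  exists tl0 tr0, forall tl tr,
    classical_rel o a b bl br tl tr = (tl == tl0) && (tr == tr0).
Proof.
have [S ->] := arc_right a (cone X) bl.
have [E ->] := arc_right b S br.
by eexists; eexists => tl tr; rewrite classical_regions.
Qed.

Definition crossing_rel (k : crossing) a b bl br tl tr :=
  if k is Classical o then classical_rel o a b bl br tl tr
  else (tl == br) && (tr == bl).

(** Around a triple of crossings the four regions at the bottom are G0, ..., G3;
   K and K' are the regions inside the triangle on the two sides of the move, H1
   and H2 the new ones at the top.  The assumption leaves out the two cyclic
   configurations. *)
Lemma third_regions o12 o13 o23 (G0 G1 G2 G3 : X)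
    (K := fourth o12 G0 G1 G2) (H2 := fourth o13 K G2 G3)
    (K' := fourth o23 G1 G2 G3) (H1 := fourth o13 G0 G1 K') :
  (o13 == o12) || (o13 == o23) ->
  fourth o23 G0 K H2 = H1 /\ fourth o12 H1 K' G3 = H2.
Proof.
rewrite {}/H1 {}/H2 {}/K {}/K'; move: o12 o13 o23 => [] [] [] //= _;
  by rewrite /fourth ?sinvM ?sinvK ?starA ?starKV ?starK ?starKV ?starVr ?star1l
     ?starKV.
Qed.

Lemma crossing_closed A k a b bl br tl tr :
  biq_closed A -> crossing_rel k a b bl br tl tr ->
  (bl \in A) || (tr \in A) -> (br \in A) || (tl \in A) ->
  [/\ bl \in A, br \in A, tl \in A & tr \in A].
Proof.
case: k => [|o] clA; last exact: classical_closed.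
by move=> /andP[/eqP-> /eqP->]; rewrite !orbb => -> ->.
Qed.

Lemma crossing_rot k a b bl br tl tr :
  crossing_rel (mirror k) b (~~ a) br tr bl tl = crossing_rel k a b bl br tl tr.
Proof.
case: k => [|o]; last exact: classical_rot.
by rewrite /= andbC eq_sym [tr == _]eq_sym eq_sym.
Qed.

Lemma crossing_flip k a b bl br tl tr :
  crossing_rel (mirror k) b a bl br tl tr = crossing_rel k a b tl tr bl br.
Proof.
case: k => [|o]; last exact: classical_flip.
by rewrite /= andbC [bl == _]eq_sym [br == _]eq_sym.
Qed.

Lemma crossing_total k a b bl br :
  exists tl0 tr0, forall tl tr,
    crossing_rel k a b bl br tl tr = (tl == tl0) && (tr == tr0).
Proof. by case: k => [|o]; [exists br, bl | exact: classical_total]. Qed.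

Lemma crossing_det k a b bl br tl tr tl' tr' :
  crossing_rel k a b bl br tl tr -> crossing_rel k a b bl br tl' tr' ->
  tl = tl' /\ tr = tr'.
Proof.
have [u [v E]] := crossing_total k a b bl br.
by rewrite !E => /andP[/eqP-> /eqP->] /andP[/eqP-> /eqP->].
Qed.

Lemma crossing_kinkR k a x :
  exists z0, forall z w, crossing_rel k a a x z w z = (w == x) && (z == z0).
Proof.
case: k => [|o]; last exact: classical_kink.
by exists x => z w /=; case: (eqVneq z x) => [->|]; rewrite ?andbF.
Qed.

Lemma crossing_kinkL k a x :
  exists z0, forall z w, crossing_rel k a a z x z w = (w == x) && (z == z0).
Proof.
(* A half turn exchanges the two kinds of kinks. *)
have turn z w :
    crossing_rel k a a z x z w = crossing_rel k (~~ a) (~~ a) w z x z.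
  by rewrite -[LHS]crossing_rot -[LHS]crossing_rot; case: k => [|[]].
have [z0 E] := crossing_kinkR k (~~ a) x; exists z0 => z w; rewrite turn.
case: (eqVneq w x) => [-> | nwx]; first by rewrite E eqxx.
by have [z1 ->] := crossing_kinkR k (~~ a) w; rewrite eq_sym (negPf nwx).
Qed.

Lemma crossing_third k12 k13 k23 a b c x1 x2 x3 z1 z2 z3 :
  third_move_ok k12 k13 k23 ->
  (exists p q r, [/\ crossing_rel k12 a b x1 x2 p q,
                     crossing_rel k13 a c q x3 r z3
                   & crossing_rel k23 b c p r z1 z2]) <->
  (exists p q r, [/\ crossing_rel k23 b c x2 x3 p q,
                     crossing_rel k13 a c x1 p z1 r
                   & crossing_rel k12 a b r q z2 z3]).
Proof.
case: k12 k13 k23 => [|o12] [|o13] [|o23] //=; first last.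
- have [G1 ->] := arc_right a (cone X) x1.
  have [G2 ->] := arc_right b G1 x2.
  have [G3 ->] := arc_right c G2 x3.
  set G0 := cone X; move=> /(third_regions G0 G1 G2 G3).
  set K := fourth o12 G0 G1 G2; set K' := fourth o23 G1 G2 G3.
  set H2 := fourth o13 K G2 G3; set H1 := fourth o13 G0 G1 K' => -[e1 e2].
  split=> -[p [q [r]]].
    rewrite !classical_regions => -[/andP[/eqP-> /eqP->]].
    rewrite !classical_regions => /andP[/eqP-> /eqP->].
    rewrite !classical_regions e1 => /andP[/eqP-> /eqP->].
    exists (arc c K' G1), (arc b G3 K'), (arc a K' H1).
    by rewrite !classical_regions e2 !eqxx.
  rewrite !classical_regions => -[/andP[/eqP-> /eqP->]].
  rewrite !classical_regions => /andP[/eqP-> /eqP->].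
  rewrite !classical_regions e2 => /andP[/eqP-> /eqP->].
  exists (arc b K G0), (arc a G2 K), (arc c H2 K).
  by rewrite !classical_regions e1 !eqxx.
(* A strand that crosses the others virtually keeps its color. *)
all: move=> _; split=> -[p [q [r []]]];
  repeat match goal with
    | |- is_true (_ && _) -> _ => case/andP => /eqP ? /eqP ?; subst
    | |- is_true (classical_rel _ _ _ _ _ _ _) -> _ => move=> ?
    end;
  do 3 eexists; split;
  first [eassumption | by apply/andP; split; apply/eqP; reflexivity].
Qed.
End Brace.

(** * Rows of colors *)

Section Rows.
Variable X : finSkewBrace.
Local Notation row := (seq X).
Implicit Types (b t u v : row) (p q : X) (w : seq slice) (T : seq row).
Implicit Types (A : {set X}).

Definition event_rel (e : event) (u v : row) : bool :=
  match e, u, v with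
  | Cup _, [::], [:: p; q] => p == q
  | Cap _, [:: p; q], [::] => p == q
  | Cross k a b, [:: bl; br], [:: tl; tr] => crossing_rel k a b bl br tl tr
  | _, _, _ => false
  end.

Lemma event_rel_size e u v :
  event_rel e u v -> size u = size (bot e) /\ size v = size (top e).
Proof.
by case: e u v => [o|o|k a c] [|? [|? [|? ?]]] [|? [|? [|? ?]]].
Qed.

Definition step (s : slice) b t : bool :=
  let m := size (sleft s) in
  let i := size (bot (sevent s)) in let j := size (top (sevent s)) in
  [&& size b == size (sbot s), size t == size (stop s),
      take m b == take m t, drop (m + i) b == drop (m + j) t &
      event_rel (sevent s) (take i (drop m b)) (take j (drop m t))].

Lemma stepP s b t :
  reflect (exists (x u v y : row),
             [/\ b = x ++ u ++ y, t = x ++ v ++ y, size x = size (sleft s),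
                 size y = size (sright s) & event_rel (sevent s) u v])
          (step s b t).
Proof.
case: s => l e r; rewrite /step /sbot /stop /= !size_cat.
apply: (iffP and5P) => [[/eqP sb /eqP st /eqP et /eqP ed loc] | ].
  exists (take (size l) b), (take (size (bot e)) (drop (size l) b)),
    (take (size (top e)) (drop (size l) t)), (drop (size l + size (bot e)) b).
  split=> //.
  - by rewrite addnC -drop_drop !cat_take_drop.
  - by rewrite ed et addnC -drop_drop !cat_take_drop.
  - by rewrite size_takel // sb leq_addr.
  - by rewrite size_drop sb addnA addKn.
move=> [x [u [v [y [-> -> sx sy loc]]]]].
have [su sv] := event_rel_size loc.
have drop2 (z : row) : drop (size x + size z) (x ++ z ++ y) = y.
  by rewrite catA -size_cat drop_size_cat.
by rewrite !size_cat sx sy -su -sv -sx !drop2 !take_size_cat //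
  !drop_size_cat // !take_size_cat // !eqxx.
Qed.

Definition steps s b : seq row :=
  [seq t <- [seq val t | t : (size (stop s)).-tuple X] | step s b t].

Lemma mem_steps s b t : (t \in steps s b) = step s b t.
Proof.
rewrite mem_filter; case st: (step s b t) => //=.
have sz : size t == size (stop s) by case/and5P: st.
by apply/imageP; exists (Tuple sz).
Qed.

Lemma steps_uniq s b : uniq (steps s b).
Proof.
by rewrite filter_uniq // map_inj_uniq ?enum_uniq //; apply: val_inj.
Qed.

(** T lists the rows above the row b, which is at the bottom of w. *)
Fixpoint runs w b T : bool :=
  match w, T with
  | [::], [::] => true
  | s :: w', t :: T' => step s b t && runs w' t T'
  | _, _ => false
  end.

Fixpoint traces w b : seq (seq row) :=
  if w is s :: w' then
    flatten [seq [seq t :: T | T <- traces w' t] | t <- steps s b]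
  else [:: [::]].

Lemma mem_traces w b T : (T \in traces w b) = runs w b T.
Proof.
elim: w b T => [|s w IH] b [|t T] //=.
  by apply/negP => /flatten_mapP[t _ /mapP[]].
apply/flatten_mapP/andP => [[t' + /mapP[T' + [-> ->]]] | [st rT]].
  by rewrite mem_steps IH.
by exists t; rewrite ?mem_steps // map_f // IH.
Qed.

Lemma traces_uniq w b : uniq (traces w b).
Proof.
elim: w b => [|s w IH] b //=.
apply: allpairs_uniq_dep (steps_uniq s b) _ _ => [t _|]; first exact: IH.
by move=> [t T] [t' T'] _ _ [-> ->].
Qed.

(** Colorings of w are determined by their bottom and top rows, and do not use
   colors outside of the biquandle closure of these rows. *)
Definition tame n w :=
  forall b, size b = n ->
   (forall T T', runs w b T -> runs w b T' -> last b T = last b T' -> T = T')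
   /\ (forall T A, runs w b T -> biq_closed A -> all (mem A) b ->
         all (mem A) (last b T) -> all (mem A) (flatten T)).

Definition same_ends n w w' :=
  forall b t, size b = n ->
   (exists2 T, runs w b T & last b T = t) <->
   (exists2 T, runs w' b T & last b T = t).

Lemma row_split i j k (b : row) :
  size b = i + (j + k) ->
  exists x u y, [/\ b = x ++ u ++ y, size x = i, size u = j & size y = k].
Proof.
move=> sb; exists (take i b), (take j (drop i b)), (drop j (drop i b)).
rewrite !cat_take_drop !size_drop sb size_takel ?sb ?leq_addr //.
by rewrite size_takel ?size_drop ?sb !addKn ?leq_addr.
Qed.

Lemma step_inv l e r (x u y : row) t :
  size x = size l -> size u = size (bot e) -> size y = size r ->
  step (Slice l e r) (x ++ u ++ y) t ->
  exists2 v, t = x ++ v ++ y & event_rel e u v.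
Proof.
move=> sx su sy /stepP[x' [u' [v [y' [/= eb -> sx' sy' loc]]]]].
have [su' _] := event_rel_size loc.
move/eqP: eb; rewrite eqseq_cat ?sx // => /andP[/eqP-> ].
by rewrite eqseq_cat ?su // => /andP[/eqP-> /eqP->]; exists v.
Qed.

Lemma step_intro l e r (x u v y : row) :
  size x = size l -> size y = size r -> event_rel e u v ->
  step (Slice l e r) (x ++ u ++ y) (x ++ v ++ y).
Proof. by move=> sx sy loc; apply/stepP; exists x, u, v, y. Qed.
End Rows.

(** * The local moves *)

(* For moves of fixed width: splits rows into their entries, and replaces the
   equalities between entries by substitutions. *)
Ltac destruct_rows :=
  repeat match goal with
  | |- is_true (runs _ _ ?T) -> _ =>
      is_var T; case: T => [|? [|? [|? [|? ?]]]] //=; rewrite ?andbF //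
  | |- is_true (step _ _ ?t) -> _ =>
      is_var t; rewrite {1}/step;
      case: t => [|? [|? [|? [|? ?]]]] //=; rewrite ?andbF //
  | |- is_true (_ && _) -> _ => case/andP
  | |- is_true true -> _ => move=> _
  | |- is_true ((_ :: _) == _) -> _ => rewrite eqseq_cons
  | |- is_true ([::] == [::]) -> _ => move=> _
  | |- is_true (_ == _) -> _ => move/eqP => ?; subst
  | |- is_true (crossing_rel _ _ _ _ _ _ _) -> _ => move=> ?
  end.

Ltac destruct_in :=
  repeat match goal with
  | |- is_true (_ && _) -> _ => case/andP
  | |- _ -> _ => move=> ?
  end; repeat (apply/andP; split); try done.

Section Moves.
Variable X : finSkewBrace.
Local Notation row := (seq X).
Implicit Types (x y z p q : X) (T : seq row) (A : {set X}).

(** What a state sum needs in order that w can be replaced by w' above rows of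
   size n. *)
Definition interchangeable n w w' :=
  [/\ tame X n w, tame X n w' & same_ends X n w w'].

(** For most moves the colorings of both sides with a given bottom row b are
   parametrized by the same set, namely the i with Q i; all that remains is to
   write them down. *)
Lemma interchangeable_of_param n w w' :
  (forall b : row, size b = n ->
   exists (I : Type) (Q : I -> Prop) (mL mR : I -> seq row),
    [/\ forall T, runs w b T <-> exists2 i, T = mL i & Q i,
        forall T, runs w' b T <-> exists2 i, T = mR i & Q i,
        forall i, last b (mL i) = last b (mR i),
        forall i j, Q i -> Q j -> last b (mL i) = last b (mL j) -> i = j
      & forall i A, Q i -> biq_closed A ->
          all (mem A) b -> all (mem A) (last b (mL i)) ->
          all (mem A) (flatten (mL i)) && all (mem A) (flatten (mR i))]) ->
  interchangeable n w w'.
Proof.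
move=> par; split=> [b sb|b sb|b t sb];
  have [I [Q [mL [mR [eL eR eLR inj clo]]]]] := par b sb.
- split=> [T T' | T A] /eL[i -> hi].
    by case/eL => j -> hj /inj->.
  by move=> clA bA tA; case/andP: (clo i A hi clA bA tA).
- split=> [T T' | T A] /eR[i -> hi].
    by case/eR => j -> hj; rewrite -!eLR => /inj->.
  by rewrite -eLR => clA bA tA; case/andP: (clo i A hi clA bA tA).
split=> -[T].
  by case/eL => i -> hi <-; exists (mR i) => //; apply/eR; exists i.
by case/eR => i -> hi <-; exists (mL i) => //; apply/eL; exists i.
Qed.

Lemma interchangeable_swingcap k o c :
  interchangeable 3
    [:: Slice [:: o] (Cross k c (~~ o)) [::]; Slice [::] (Cap o) [:: c]]
    [:: Slice [::] (Cross (mirror k) o c) [:: ~~ o]; Slice [:: c] (Cap o) [::]].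
Proof.
have e x y z q :
    crossing_rel (mirror k) o c x y q z = crossing_rel k c (~~ o) y z x q.
  by rewrite -crossing_rot; case: k => [|[]].
apply: interchangeable_of_param => -[|x [|y [|z []]]] // _.
exists X, (crossing_rel k c (~~ o) y z x),
  (fun q => [:: [:: x; x; q]; [:: q]]), (fun q => [:: [:: q; z; z]; [:: q]]).
split=> //.
- move=> T; split; last first.
    by case=> q -> /= h; rewrite /step /= !eqseq_cons !eqxx h.
  by destruct_rows; eexists.
- move=> T; split; last first.
    by case=> q -> /= h; rewrite /step /= !eqseq_cons !eqxx e h.
  by destruct_rows; eexists; first by []; rewrite -e.
- by move=> i j _ _ [].
by move=> q A h _ /=; destruct_in.
Qed.

Lemma interchangeable_swingcup k o c :
  interchangeable 1
    [:: Slice [::] (Cup o) [:: c]; Slice [:: o] (Cross k (~~ o) c) [::]]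
    [:: Slice [:: c] (Cup o) [::]; Slice [::] (Cross (mirror k) c o) [:: ~~ o]].
Proof.
have e x y z q :
    crossing_rel (mirror k) c o x y q z = crossing_rel k (~~ o) c q x z y.
  by rewrite -[RHS]crossing_rot negbK.
apply: interchangeable_of_param => -[|x []] // _.
exists (X * X * X)%type,
  (fun i => let: (r, s, p) := i in crossing_rel k (~~ o) c r x s p),
  (fun i => let: (r, s, p) := i in [:: [:: r; r; x]; [:: r; s; p]]),
  (fun i => let: (r, s, p) := i in [:: [:: x; p; p]; [:: r; s; p]]).
split=> //.
- move=> T; split; last first.
    by case=> -[[r s] p] -> /= h; rewrite /step /= !eqseq_cons !eqxx h.
  by destruct_rows; eexists (_, _, _).
- move=> T; split; last first.
    by case=> -[[r s] p] -> /= h; rewrite /step /= !eqseq_cons !eqxx e h.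
  by destruct_rows; eexists (_, _, _); first by []; rewrite -e.
- by case=> [[]].
- by case=> [[? ?] ?] [[? ?] ?] _ _ [-> -> ->].
by move=> [[r s] p] A h _ /=; destruct_in.
Qed.

Lemma interchangeable_zigzagR o :
  interchangeable 1
    [:: Slice [:: o] (Cup (~~ o)) [::]; Slice [::] (Cap o) [:: o]]
    [::].
Proof.
apply: interchangeable_of_param => -[|x []] // _.
exists unit, xpredT, (fun _ => [:: [:: x; x; x]; [:: x]]), (fun _ => [::]).
split=> //.
- move=> T; split; last by case=> q -> /= h; rewrite /step /= !eqseq_cons !eqxx.
  by destruct_rows; exists tt.
- by case=> [|? ?]; split=> //; first [by exists tt | by case].
- by case=> [[]].
by move=> _ A _ _ /=; destruct_in.
Qed.

Lemma interchangeable_zigzagL o :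
  interchangeable 1
    [:: Slice [::] (Cup o) [:: o]; Slice [:: o] (Cap (~~ o)) [::]]
    [::].
Proof.
apply: interchangeable_of_param => -[|x []] // _.
exists unit, xpredT, (fun _ => [:: [:: x; x; x]; [:: x]]), (fun _ => [::]).
split=> //.
- move=> T; split; last by case=> q -> /= h; rewrite /step /= !eqseq_cons !eqxx.
  by destruct_rows; exists tt.
- by case=> [|? ?]; split=> //; first [by exists tt | by case].
- by case=> [[]].
by move=> _ A _ _ /=; destruct_in.
Qed.

(** The loop has no end on the boundary, but its color z0 is in any
   biquandle-closed set that contains x, since x is also the color of one end of
   each strand of the crossing. *)
Lemma interchangeable_firstR k o : interchangeable 1
      [:: Slice [:: o] (Cup o) [::];
          Slice [::] (Cross k o o) [:: ~~ o];
          Slice [:: o] (Cap o) [::]]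
      [::].
Proof.
apply: interchangeable_of_param => -[|x []] // _.
have [z0 kz] := crossing_kinkR k o x.
exists unit, xpredT,
  (fun _ => [:: [:: x; z0; z0]; [:: x; z0; z0]; [:: x]]), (fun _ => [::]).
split=> //.
- move=> T; split; last first.
    by case=> q -> /= h; rewrite /step /= !eqseq_cons kz !eqxx.
  destruct_rows.
  match goal with h : is_true (crossing_rel _ _ _ _ _ _ _) |- _ => move: h end.
  rewrite kz => /andP[/eqP-> /eqP->].
  by exists tt.
- by case=> [|? ?]; split=> //; first [by exists tt | by case].
- by case=> [[]].
move=> _ A _ clA /= /andP[xA _] _.
have : crossing_rel k o o x z0 x z0 by rewrite kz !eqxx.
by move/(crossing_closed clA); rewrite xA orbT => /(_ isT isT)[_ -> _ _].
Qed.

Lemma interchangeable_firstL k o : interchangeable 1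
      [:: Slice [::] (Cup (~~ o)) [:: o];
          Slice [:: ~~ o] (Cross k o o) [::];
          Slice [::] (Cap (~~ o)) [:: o]]
      [::].
Proof.
apply: interchangeable_of_param => -[|x []] // _.
have [z0 kz] := crossing_kinkL k o x.
exists unit, xpredT,
  (fun _ => [:: [:: z0; z0; x]; [:: z0; z0; x]; [:: x]]), (fun _ => [::]).
split=> //.
- move=> T; split; last first.
    by case=> q -> /= h; rewrite /step /= !eqseq_cons kz !eqxx.
  destruct_rows.
  match goal with h : is_true (crossing_rel _ _ _ _ _ _ _) |- _ => move: h end.
  rewrite kz => /andP[/eqP-> /eqP->].
  by exists tt.
- by case=> [|? ?]; split=> //; first [by exists tt | by case].
- by case=> [[]].
move=> _ A _ clA /= /andP[xA _] _.
have : crossing_rel k o o z0 x z0 x by rewrite kz !eqxx.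
by move/(crossing_closed clA); rewrite xA orbT => /(_ isT isT)[-> _ _ _].
Qed.

Lemma interchangeable_second k a b : interchangeable 2
      [:: Slice [::] (Cross k a b) [::];
          Slice [::] (Cross (mirror k) b a) [::]] [::].
Proof.
apply: interchangeable_of_param => -[|x [|y []]] // _.
have [p0 [q0 E]] := crossing_total k a b x y.
have E0 : crossing_rel k a b x y p0 q0 by rewrite E !eqxx.
exists unit, xpredT, (fun _ => [:: [:: p0; q0]; [:: x; y]]), (fun _ => [::]).
split=> //.
- move=> T; split; last by case=> i -> _ /=; rewrite /step /= crossing_flip E0.
  clear E0; destruct_rows.
  repeat match goal with
  | h : is_true (crossing_rel _ _ _ _ _ _ _) |- _ => move: h
  end.
  rewrite E => /andP[/eqP-> /eqP->] E2.
  have E1 : crossing_rel (mirror k) b a p0 q0 x y.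
    by rewrite crossing_flip E !eqxx.
  by have [-> ->] := crossing_det E1 E2; exists tt.
- by case=> [|? ?]; split=> //; first [by exists tt | by case].
- by case=> [[]].
move=> _ A _ clA /= /and3P[xA yA _] _.
by have := crossing_closed clA E0; rewrite xA yA => /(_ isT isT)[_ _ -> ->].
Qed.

Lemma interchangeable_third k12 k13 k23 a b c :
  third_move_ok k12 k13 k23 ->
  interchangeable 3
      [:: Slice [::] (Cross k12 a b) [:: c];
          Slice [:: b] (Cross k13 a c) [::];
          Slice [::] (Cross k23 b c) [:: a]]
      [:: Slice [:: a] (Cross k23 b c) [::];
          Slice [::] (Cross k13 a c) [:: b];
          Slice [:: c] (Cross k12 a b) [::]].
Proof.
move=> ok.
set w := (X in interchangeable _ X _); set w' := (X in interchangeable _ _ X).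
have eL x1 x2 x3 T : runs w [:: x1; x2; x3] T -> exists p q r z1 z2 z3,
   T = [:: [:: p; q; x3]; [:: p; r; z3]; [:: z1; z2; z3]] /\
   [/\ crossing_rel k12 a b x1 x2 p q, crossing_rel k13 a c q x3 r z3
                    & crossing_rel k23 b c p r z1 z2].
  by rewrite {}/w; destruct_rows; do 6 eexists; split; first by []; split.
have eR x1 x2 x3 T : runs w' [:: x1; x2; x3] T -> exists p q r z1 z2 z3,
   T = [:: [:: x1; p; q]; [:: z1; r; q]; [:: z1; z2; z3]] /\
   [/\ crossing_rel k23 b c x2 x3 p q, crossing_rel k13 a c x1 p z1 r
                    & crossing_rel k12 a b r q z2 z3].
  by rewrite {}/w'; destruct_rows; do 6 eexists; split; first by []; split.
split=> [s|s|s t]; case: s => [|x1 [|x2 [|x3 []]]] // _.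
- split=> [T T' | T A].
    move=> /eL[p [q [r [z1 [z2 [z3 [-> [h1 h2 h3]]]]]]]].
    move=> /eL[p' [q' [r' [z1' [z2' [z3' [-> [h1' h2' h3']]]]]]]] /= [<- <- <-].
    have [ep eq] := crossing_det h1 h1'; subst.
    by have [-> _] := crossing_det h2 h2'.
  move=> /eL[p [q [r [z1 [z2 [z3 [-> [h1 h2 h3]]]]]]]] clA.
  move=> /= /and4P[x1A x2A x3A _] /and4P[z1A z2A z3A _].
  have [_ _ pA qA] : [/\ x1 \in A, x2 \in A, p \in A & q \in A].
    by apply: (crossing_closed clA h1); rewrite ?x1A ?x2A.
  have [_ _ rA _] : [/\ q \in A, x3 \in A, r \in A & z3 \in A].
    by apply: (crossing_closed clA h2); rewrite ?qA ?x3A.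
  by rewrite pA qA rA x3A z1A z2A z3A.
- split=> [T T' | T A].
    move=> /eR[p [q [r [z1 [z2 [z3 [-> [h1 h2 h3]]]]]]]].
    move=> /eR[p' [q' [r' [z1' [z2' [z3' [-> [h1' h2' h3']]]]]]]] /= [<- <- <-].
    have [ep eq] := crossing_det h1 h1'; subst.
    by have [_ ->] := crossing_det h2 h2'.
  move=> /eR[p [q [r [z1 [z2 [z3 [-> [h1 h2 h3]]]]]]]] clA.
  move=> /= /and4P[x1A x2A x3A _] /and4P[z1A z2A z3A _].
  have [_ _ pA qA] : [/\ x2 \in A, x3 \in A, p \in A & q \in A].
    by apply: (crossing_closed clA h1); rewrite ?x2A ?x3A.
  have [_ _ _ rA] : [/\ x1 \in A, p \in A, z1 \in A & r \in A].
    by apply: (crossing_closed clA h2); rewrite ?x1A ?pA.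
  by rewrite pA qA rA x1A z1A z2A z3A.
split=> -[T].
  move=> /eL[p [q [r [z1 [z2 [z3 [-> h]]]]]]] <-.
  have [|p' [q' [r' [h1 h2 h3]]]] :=
    (crossing_third a b c x1 x2 x3 z1 z2 z3 ok).1; first by exists p, q, r.
  exists [:: [:: x1; p'; q']; [:: z1; r'; q']; [:: z1; z2; z3]] => //.
  by rewrite /w' /= /step /= !eqseq_cons !eqxx h1 h2 h3.
move=> /eR[p [q [r [z1 [z2 [z3 [-> h]]]]]]] <-.
have [|p' [q' [r' [h1 h2 h3]]]] :=
  (crossing_third a b c x1 x2 x3 z1 z2 z3 ok).2; first by exists p, q, r.
exists [:: [:: p'; q'; x3]; [:: p'; r'; z3]; [:: z1; z2; z3]] => //.
by rewrite /w /= /step /= !eqseq_cons !eqxx h1 h2 h3.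
Qed.

Lemma interchangeable_exchange e1 (m : level) e2 :
  interchangeable (size (bot e1 ++ m ++ bot e2))
      [:: Slice [::] e1 (m ++ bot e2); Slice (top e1 ++ m) e2 [::]]
      [:: Slice (bot e1 ++ m) e2 [::]; Slice [::] e1 (m ++ top e2)].
Proof.
have n0 : size ([::] : row) = size ([::] : level) by [].
apply: interchangeable_of_param => b; rewrite !size_cat.
case/row_split=> [u1 [mm [u2 [-> su1 sm su2]]]].
exists (row * row)%type,
  (fun v => event_rel e1 u1 v.1 && event_rel e2 u2 v.2),
  (fun v => [:: v.1 ++ mm ++ u2; v.1 ++ mm ++ v.2]),
  (fun v => [:: u1 ++ mm ++ v.2; v.1 ++ mm ++ v.2]).
split=> //.
- move=> T; split.
    case: T => [|t1 [|t2 [|??]]] //=; rewrite ?andbF // andbT => /andP[].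
    move=> /(@step_inv _ _ _ _ [::] u1 (mm ++ u2))[] //.
      by rewrite !size_cat sm su2.
    move=> v1 -> l1; have [_ sv1] := event_rel_size l1.
    have sv1m : size (v1 ++ mm) = size (top e1 ++ m).
      by rewrite !size_cat sv1 sm.
    rewrite /= catA -{1}[u2]cats0 => /(step_inv sv1m su2 n0)[v2 -> l2].
    by exists (v1, v2); rewrite /= ?cats0 ?catA // l1.
  case=> -[v1 v2] -> /andP[/= l1 l2]; have [_ sv1] := event_rel_size l1.
  rewrite andbT; apply/andP; split.
    by apply: (@step_intro _ _ _ _ [::]); rewrite // !size_cat sm su2.
  rewrite !catA -[u2]cats0 -[v2]cats0.
  by apply: step_intro; rewrite // !size_cat sv1 sm.
- move=> T; split.
    case: T => [|t1 [|t2 [|??]]] //=; rewrite ?andbF // andbT => /andP[].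
    have su1m : size (u1 ++ mm) = size (bot e1 ++ m).
      by rewrite !size_cat su1 sm.
    rewrite catA -{1}[u2]cats0 => /(step_inv su1m su2 n0)[v2 -> l2].
    have [_ sv2] := event_rel_size l2.
    rewrite cats0 -catA => /(@step_inv _ _ _ _ [::] u1 (mm ++ v2))[] //.
      by rewrite !size_cat sm sv2.
    by move=> v1 -> l1; exists (v1, v2); rewrite //= l1.
  case=> -[v1 v2] -> /andP[/= l1 l2]; have [_ sv2] := event_rel_size l2.
  rewrite andbT; apply/andP; split.
    rewrite !catA -[u2]cats0 -[v2]cats0.
    by apply: step_intro; rewrite // !size_cat su1 sm.
  by apply: (@step_intro _ _ _ _ [::]); rewrite // !size_cat sm sv2.
- move=> [v1 v2] [v1' v2'] /andP[/= /event_rel_size[_ s1] _].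
  move=> /andP[/= /event_rel_size[_ s1'] _] /eqP.
  by rewrite eqseq_cat ?s1 ?s1' // eqseq_cat // => /and3P[/eqP-> _ /eqP->].
move=> [v1 v2] A /andP[_ _] _ /=; rewrite !all_cat /= => /and3P[-> -> ->].
by move=> /and3P[-> _ ->].
Qed.

Definition foot w : level := if w is s :: _ then sbot s else [::].

Lemma interchangeable_move w w' :
  planar_move w w' \/ reidemeister_move w w' ->
  ~~ nilp w /\ interchangeable (size (foot w)) w w'.
Proof.
case=> -[] *; split=> //.
- exact: interchangeable_exchange.
- exact: interchangeable_zigzagR.
- exact: interchangeable_zigzagL.
- exact: interchangeable_swingcap.
- exact: interchangeable_swingcup.
- exact: interchangeable_firstR.
- exact: interchangeable_firstL.
- exact: interchangeable_second.
exact: interchangeable_third.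
Qed.
End Moves.

(** * Moves inside a diagram *)

Section Whisker.
Variable X : finSkewBrace.
Local Notation row := (seq X).
Implicit Types (w : seq slice) (T : seq row) (A : {set X}).

Lemma step_whisker (l r : level) s (x b y t : row) :
  size x = size l -> size y = size r ->
  step (Slice (l ++ sleft s) (sevent s) (sright s ++ r)) (x ++ b ++ y) t
  <-> exists2 t0, t = x ++ t0 ++ y & step s b t0.
Proof.
case: s => sl e sr /= sx sy; split=> [st | [t0 -> /stepP]]; last first.
  move=> [b1 [u [v [b2 [-> -> /= s1 s2 loc]]]]].
  rewrite -!catA !(catA x); apply: step_intro => //.
    by rewrite size_cat sx s1 -size_cat.
  by rewrite size_cat sy s2 -size_cat.
have : size b = size sl + (size (bot e) + size sr).
  case/and5P: (st) => /eqP; rewrite /sbot /= !size_cat sx sy => /eqP.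
  by rewrite -!addnA eqn_add2l !addnA eqn_add2r => /eqP.
case/row_split=> [b1 [u [b2 [eb e1 e2 e3]]]]; rewrite {}eb in st *.
have [] := @step_inv X (l ++ sl) e (sr ++ r) (x ++ b1) u (b2 ++ y) t _ e2 _.
- by rewrite !size_cat sx e1.
- by rewrite !size_cat sy e3.
- by move: st; rewrite !catA.
move=> v -> loc; exists (b1 ++ v ++ b2); first by rewrite !catA.
exact: step_intro.
Qed.

Lemma runs_whisker (l r : level) w (x b y : row) T :
  size x = size l -> size y = size r ->
  runs (whisker l r w) (x ++ b ++ y) T
  <-> exists2 T0, T = [seq x ++ t ++ y | t <- T0] & runs w b T0.
Proof.
move=> sx sy; elim: w b T => [|s w IH] b [|t T] /=.
- by split=> // _; exists [::].
- by split=> // -[[]].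
- by split=> // -[[]].
split=> [/andP[/step_whisker[] // t0 -> st /IH[T0 -> rT]]|].
  by exists (t0 :: T0); rewrite //= st.
move=> [[|t0 T0] //= [-> ->] /andP[st rT]]; apply/andP; split.
  by apply/step_whisker => //; exists t0.
by apply/IH; exists T0.
Qed.

Lemma cat_cancel (u v y : row) : u ++ y = v ++ y -> u = v.
Proof.
move=> e; have /eqP s : size u == size v.
  by rewrite -(eqn_add2r (size y)) -!size_cat e.
by move/eqP: e; rewrite eqseq_cat // => /andP[/eqP].
Qed.

Lemma interchangeable_whisker n (l r : level) w w' :
  interchangeable X n w w' ->
  interchangeable X (size l + (n + size r)) (whisker l r w) (whisker l r w').
Proof.
have lst (x y b : row) T :
    last (x ++ b ++ y) [seq x ++ t ++ y | t <- T] = x ++ last b T ++ y.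
  exact: (last_map (fun t => x ++ t ++ y)).
have tm v : tame X n v -> tame X (size l + (n + size r)) (whisker l r v).
  move=> tv _ /row_split[x [b [y [-> sx sb sy]]]].
  have [inj clo] := tv b sb; split=> [T T' | T A].
    move=> /runs_whisker[] // T0 -> r0 /runs_whisker[] // T0' -> r0' /eqP.
    rewrite !lst eqseq_cat // => /andP[_ /eqP/cat_cancel e].
    by rewrite (inj T0 T0').
  move=> /runs_whisker[] // T0 -> r0 clA; rewrite lst !all_cat.
  move=> /and3P[xA bA yA] /and3P[_ tA _].
  have := clo T0 A r0 clA bA tA; elim: (T0) => //= t T1 IH.
  by rewrite !all_cat xA yA => /andP[-> /IH->].
case=> tw tw' sm; split; [exact: tm | exact: tm |].
move=> _ t /row_split[x [b [y [-> sx sb sy]]]].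
split=> -[T /runs_whisker[] // T0 -> r0 <-].
  have [|T1 r1 e1] := (sm b (last b T0) sb).1; first by exists T0.
  exists [seq x ++ t ++ y | t <- T1]; last by rewrite !lst e1.
  by apply/runs_whisker => //; exists T1.
have [|T1 r1 e1] := (sm b (last b T0) sb).2; first by exists T0.
exists [seq x ++ t ++ y | t <- T1]; last by rewrite !lst e1.
by apply/runs_whisker => //; exists T1.
Qed.
End Whisker.

(** * State sums *)

Section StateSum.
Variables (X : finSkewBrace) (V : nmodType) (F : {set X} -> V).
Local Notation row := (seq X).
Implicit Types (w : seq slice) (T : seq row) (A S : {set X}).

Definition entries (b : row) : {set X} := [set x in b].

Lemma entries_cat (b c : row) : entries (b ++ c) = entries b :|: entries c.
Proof. by apply/setP=> x; rewrite !inE mem_cat. Qed.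

Lemma entries_sub (b : row) A : (entries b \subset A) = all (mem A) b.
Proof.
by apply/subsetP/allP => h x; [move=> xb | rewrite inE]; apply: h; rewrite ?inE.
Qed.

(** S collects the colors used below the row b, so that a sum over the colorings
   of a diagram can be cut into a sum over those of its lower part of sums over
   those of its upper part. *)
Definition state_sum w (b : row) S : V :=
  (\sum_(T <- traces w b) F (biq_closure (S :|: entries (flatten T))))%R.

Lemma state_sum_cat w1 w2 b S :
  state_sum (w1 ++ w2) b S =
  (\sum_(T <- traces w1 b)
      state_sum w2 (last b T) (S :|: entries (flatten T)))%R.
Proof.
elim: w1 b S => [|s w1 IH] b S.
  rewrite /= big_seq1 /=; congr state_sum.
  by apply/setP => x; rewrite !inE orbF.
rewrite /state_sum /= !big_flatten /= !big_map; apply: eq_bigr => t _.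
rewrite !big_map; transitivity (state_sum (w1 ++ w2) t (S :|: entries t)).
  by apply: eq_bigr => T _; rewrite /= entries_cat setUA.
by rewrite IH; apply: eq_bigr => T _; rewrite /= entries_cat setUA.
Qed.

Lemma state_sum_closure w b S S' :
  (forall A, biq_closed A -> (S \subset A) = (S' \subset A)) ->
  state_sum w b S = state_sum w b S'.
Proof.
move=> e; apply: eq_bigr => T _; congr F; apply: eq_bigl => A.
by case clA: (biq_closed A); rewrite //= !subUset e.
Qed.

(** By tameness, the colors of the middle rows may be forgotten, and then the
   sum over the colorings of w or w' becomes a sum over their possible top
   rows. *)
Lemma state_sum_interchange n w w' up b S :
  interchangeable X n w w' -> size b = n -> all (mem S) b ->
  state_sum (w ++ up) b S = state_sum (w' ++ up) b S.
Proof.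
case=> tw tw' sm sb bS; rewrite !state_sum_cat.
have red v : tame X n v ->
    (\sum_(T <- traces v b)
        state_sum up (last b T) (S :|: entries (flatten T)))%R
  = (\sum_(t <- [seq last b T | T <- traces v b])
        state_sum up t (S :|: entries t))%R.
  move=> /(_ b sb)[_ clo]; rewrite big_map !big_seq; apply: eq_bigr => T.
  rewrite mem_traces => rT; apply: state_sum_closure => A clA.
  rewrite !subUset !entries_sub; case: (boolP (S \subset A)) => //= SA.
  have bA : all (mem A) b by apply: sub_all bS => x; apply: (subsetP SA).
  apply/idP/idP => h; last exact: clo h.
  case: T h {rT} => //= t T; rewrite all_cat => /andP[tA hT].
  by elim: T t tA hT => //= t' T IH t _; rewrite all_cat => /andP[]; apply: IH.
rewrite !red //; apply: perm_big; apply: uniq_perm.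
- rewrite map_inj_in_uniq ?traces_uniq // => T T'; rewrite !mem_traces.
  exact: (tw b sb).1.
- rewrite map_inj_in_uniq ?traces_uniq // => T T'; rewrite !mem_traces.
  exact: (tw' b sb).1.
move=> t; apply/mapP/mapP => -[T]; rewrite mem_traces => rT ->.
  have [|T1 r1 e1] := (sm b (last b T) sb).1; first by exists T.
  by exists T1; rewrite ?mem_traces.
have [|T1 r1 e1] := (sm b (last b T) sb).2; first by exists T.
by exists T1; rewrite ?mem_traces.
Qed.

Lemma composable_cat l w1 w2 l' :
  composable l (w1 ++ w2) l' ->
  exists2 m, composable l w1 m & composable m w2 l'.
Proof.
elim: w1 l => [|s w1 IH] l /=; first by exists l.
by move=> /andP[-> /IH[m h1 h2]]; exists m.
Qed.

Lemma runs_last_size l w l' (b : row) T :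
  composable l w l' -> size b = size l -> runs w b T ->
  size (last b T) = size l'.
Proof.
elim: w l b T => [|s w IH] l b [|t T] //=; first by move=> /eqP->.
move=> /andP[_ cw] sb /andP[st]; apply: IH cw _.
by case/and5P: st => _ /eqP.
Qed.

Lemma foot_whisker l r w : ~~ nilp w -> foot (whisker l r w) = l ++ foot w ++ r.
Proof. by case: w => // s w _; rewrite /= /sbot /= -!catA. Qed.

Lemma state_sum_move (D D' : diagram) :
  move D D' -> state_sum D [::] set0 = state_sum D' [::] set0.
Proof.
case=> below [above [l [r [w [w' [mv eD eD']]]]]].
have /andP[_] := diagramP D; rewrite eD => /composable_cat[m cb cr].
have [w_n0] := @interchangeable_move X w w' mv.
move=> /(interchangeable_whisker l r) inter.
(* D contains w, which is not empty: this fixes the level below w even when w'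
   is empty. *)
have em : m = foot (whisker l r w).
  by move: w_n0 cr; case: (w) => // s w1 _ /= /andP[/eqP <-].
rewrite eD' !state_sum_cat !big_seq; apply: eq_bigr => T.
rewrite mem_traces => rT; apply: state_sum_interchange inter _ _.
  by rewrite (runs_last_size cb _ rT) // em foot_whisker // !size_cat.
rewrite -entries_sub; apply: subset_trans (subsetUr _ _).
case: (lastP T) => [|T1 t]; first by apply/subsetP => x; rewrite inE.
by rewrite last_rcons -cats1 flatten_cat entries_cat /= cats0 subsetUr.
Qed.
End StateSum.

(** * From functions on points to rows *)

Section Lines.
Variable X : finSkewBrace.
Local Notation row := (seq X).
Implicit Types (w : seq slice) (T : seq row) (g h : nat * nat -> X) (l : level).

Definition line (i n : nat) : seq (nat * nat) := [seq (i, j) | j <- iota 0 n].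

(** The points of the lines at the top of the slices of w, the lowest of these
   lines having number i. *)
Fixpoint upper_points i w : seq (nat * nat) :=
  if w is s :: w' then line i (size (stop s)) ++ upper_points i.+1 w' else [::].

Fixpoint rows g i w : seq row :=
  if w is s :: w' then map g (line i (size (stop s))) :: rows g i.+1 w'
  else [::].

Lemma flatten_rows g i w : flatten (rows g i w) = map g (upper_points i w).
Proof. by elim: w i => //= s w IH i; rewrite IH map_cat. Qed.

Lemma eq_rows g h i w :
  {in upper_points i w, g =1 h} <-> rows g i w = rows h i w.
Proof.
split=> [e | /(congr1 flatten)]; last by rewrite !flatten_rows => /eq_in_map.
elim: w i e => //= s w IH i e; congr cons.
  by apply/eq_in_map => p pl; apply: e; rewrite mem_cat pl.
by apply: IH => p pw; apply: e; rewrite mem_cat pw orbT.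
Qed.

Lemma mem_line i n p : (p \in line i n) = (p.1 == i) && (p.2 < n).
Proof.
case: p => a j; apply/mapP/andP => /= [[k + [-> ->]] | [/eqP-> jn]].
  by rewrite mem_iota.
by exists j; rewrite ?mem_iota.
Qed.

Lemma mem_upper_points i w p :
  (p \in upper_points i w)
    = (i <= p.1) && (p.2 < size (nth [::] (map stop w) (p.1 - i))).
Proof.
case: p => a j; elim: w i => [|s w IH] i /=.
  by rewrite nth_nil ltn0 andbF.
rewrite mem_cat mem_line IH /=; case: (ltngtP i a) => [ia|ia|->] /=.
- by rewrite -(subnSK ia).
- by [].
by rewrite subnn orbF.
Qed.

(** There are no points on the line number 0, which lies below the diagram. *)
Lemma mem_points w p : (p \in points w) = (p \in upper_points 1 w).
Proof.
case: p => i j; rewrite mem_upper_points /=.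
apply/allpairsPdep/idP => [[a [k [+ + [-> ->]]]] | ].
  by rewrite !mem_iota /= => _; case: a => //= a; rewrite subn1.
case: i => //= i; rewrite subn1 /= => jn; exists i.+1, j.
split=> //; last by rewrite mem_iota.
rewrite inE mem_iota /= add1n ltnS size_map ltnNge.
by apply: contraL jn => wi; rewrite nth_default ?size_map.
Qed.

Definition rule g (c : crossing_data) : bool :=
  if positive c
  then biq_rel (g (under_in c)) (g (over_out c))
               (g (under_out c)) (g (over_in c))
  else biq_rel (g (under_out c)) (g (over_in c))
               (g (under_in c)) (g (over_out c)).

Definition respects g i w : bool :=
  all (fun e => g e.1 == g e.2) (strands i w) && all (rule g) (crossings i w).

Lemma eq_map_all (T : Type) (f h : T -> X) s :
  ([seq f x | x <- s] == [seq h x | x <- s]) = all (fun x => f x == h x) s.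
Proof. by elim: s => //= x s IH; rewrite eqseq_cons IH. Qed.

Lemma line_cat i a b c :
  line i (a + (b + c))
    = line i a ++ [seq (i, a + j) | j <- iota 0 b]
               ++ [seq (i, a + b + j) | j <- iota 0 c].
Proof.
rewrite /line !iotaD !map_cat !add0n /= -[in iota a b](addn0 a).
rewrite -[in iota (a + b) c](addn0 (a + b)).
by rewrite !iotaDl -!map_comp.
Qed.

Lemma step_cat l e r (x u y x' v y' : row) :
  size x = size l -> size x' = size l -> size u = size (bot e) ->
  size v = size (top e) -> size y = size r -> size y' = size r ->
  step (Slice l e r) (x ++ u ++ y) (x' ++ v ++ y')
    = [&& x == x', y == y' & event_rel e u v].
Proof.
move=> sx sx' su sv sy sy'.
rewrite /step /sbot /stop /= !size_cat sx sx' su sv sy sy' !eqxx /= !catA.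
rewrite !(@drop_size_cat _ (size l + _)) ?size_cat ?sx ?sx' ?su ?sv //.
by rewrite -!catA !take_size_cat // !drop_size_cat // !take_size_cat.
Qed.

Lemma respects_slice g i s :
  all (fun e => g e.1 == g e.2) (slice_strands i s)
    && all (rule g) (slice_crossings i s)
  = step s (map g (line i (size (sbot s)))) (map g (line i.+1 (size (stop s)))).
Proof.
case: s => l e r; rewrite /sbot /stop /slice_strands /= !size_cat !line_cat.
rewrite !map_cat step_cat ?size_map ?size_iota //.
rewrite -!map_comp !eq_map_all !all_cat !all_map.
rewrite -!andbA; congr andb; rewrite andbCA; congr andb; rewrite andbC.
case: e => [o|o|[|o] a b] /=; rewrite ?addn0 ?addn1 ?andbT //.
  by rewrite andbC ![g (i, _) == _]eq_sym andbC.
by move: o a b => [] [] []; rewrite /rule /slice_crossings /= ?andbT.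
Qed.

Lemma respects_runs g i l w l' :
  composable l w l' ->
  respects g i w = runs w (map g (line i (size l))) (rows g i.+1 w).
Proof.
rewrite /respects; elim: w i l => [|s w IH] i l //= /andP[/eqP<- cw].
rewrite (all_cat _ (slice_strands i s)) (all_cat _ (slice_crossings i s)).
by rewrite -(IH _ _ cw) -respects_slice andbACA.
Qed.

Lemma rows_nth g i w b T :
  runs w b T -> (forall a j, g (i + a, j) = nth (cone X) (nth [::] T a) j) ->
  rows g i w = T.
Proof.
elim: w i b T => [|s w IH] i b [|t T] //= /andP[st rT] e.
congr cons; last first.
  by apply: IH rT _ => a j; rewrite addSnnS e.
have sz : size t = size (stop s) by case/and5P: st => _ /eqP.
rewrite -map_comp -[RHS](mkseq_nth (cone X)) sz.
by apply: eq_map => j /=; rewrite -[X in (X, _)]addn0 e.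
Qed.

Lemma strand_ends i l w l' e : composable l w l' -> e \in strands i w ->
  (e.1 \in line i (size l) ++ upper_points i.+1 w) &&
  (e.2 \in line i (size l) ++ upper_points i.+1 w).
Proof.
elim: w i l => //= s w IH i l /andP[/eqP <- cw].
rewrite mem_cat => /orP[|/(IH _ _ cw)]; last first.
  by rewrite !mem_cat => /andP[/orP[]-> /orP[]->]; rewrite ?orbT.
rewrite !mem_cat !mem_line /sbot /stop /slice_strands !size_cat.
case/or3P => [/mapP[j] | | /mapP[j]]; rewrite ?mem_iota.
- by move=> /= jl ->; rewrite /= !eqxx !ltn_addr ?orbT.
- case: (sevent s) => [o|o|[|o] a b] //=; rewrite !inE => he.
  + by rewrite (eqP he) /= eqxx; lia.
  + by rewrite (eqP he) /= eqxx; lia.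
  by case/orP: he => /eqP-> /=; rewrite !eqxx; lia.
by move=> /= jr ->; rewrite /= !eqxx -!addnA !ltn_add2l jr ?orbT.
Qed.

Definition crossing_points c :=
  [:: under_in c; under_out c; over_in c; over_out c].

Lemma all_crossing_ends i l w l' : composable l w l' ->
  all (fun c => all (mem (line i (size l) ++ upper_points i.+1 w))
                    (crossing_points c))
      (crossings i w).
Proof.
elim: w i l => //= s w IH i l /andP[/eqP <- cw].
rewrite all_cat; apply/andP; split; last first.
  apply: sub_all (IH _ _ cw) => c /=; rewrite !(mem_cat _ (line i _)).
  by case/and5P=> -> -> -> -> _; rewrite !orbT.
rewrite /slice_crossings /sbot /stop !size_cat.
case: (sevent s) => [o|o|[|[]] [] []] //=.
all: by rewrite !mem_cat !mem_line /= !eqxx; lia.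
Qed.

Lemma eq_all_under (T : Type) (P a b : pred T) s :
  all P s -> (forall c, P c -> a c = b c) -> all a s = all b s.
Proof. by elim: s => //= c s IH /andP[Pc Ps] e; rewrite e // IH. Qed.
End Lines.

(** * Colorings of semiarcs as sequences of rows *)

Section Semiarcs.
Variables (X : finSkewBrace) (D : diagram).
Implicit Types (f : {ffun semiarc D -> X}) (A : semiarc D) (p q : point D).

Lemma joined_sym : connect_sym (@joined D).
Proof. by apply: sym_connect_sym => p q; rewrite /joined /= orbC. Qed.

Lemma joined_equiv : equivalence_rel (connect (@joined D)).
Proof.
move=> p q r; split=> [|pq]; first exact: connect0.
exact: (same_connect joined_sym).
Qed.

Lemma semiarcs_partition : partition (semiarcs D) [set: point D].
Proof.
by apply: equivalence_partitionP => p q r _ _ _; apply: joined_equiv.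
Qed.

Lemma semiarc_of_subproof p : pblock (semiarcs D) p \in semiarcs D.
Proof.
have /and3P[/eqP cov _ _] := semiarcs_partition.
by rewrite pblock_mem // cov inE.
Qed.

Definition semiarc_of p : semiarc D :=
  exist (fun A : {set point D} => A \in semiarcs D) _ (semiarc_of_subproof p).

Lemma mem_semiarc_of p q : (q \in val (semiarc_of p)) = connect (@joined D) p q.
Proof.
rewrite /= pblock_equivalence_partition ?inE // => ? ? ? _ _ _.
exact: joined_equiv.
Qed.

Lemma semiarc_ofE p A : (p \in val A) = (A == semiarc_of p).
Proof.
have /and3P[_ tI _] := semiarcs_partition.
apply/idP/eqP => [pA | ->]; last by rewrite mem_semiarc_of connect0.
by apply: val_inj; rewrite /= (def_pblock tI (valP A) pA).
Qed.

Lemma semiarc_ex A : exists p, A = semiarc_of p.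
Proof.
have /and3P[_ _ n0] := semiarcs_partition.
have [A0 | [p pA]] := set_0Vmem (val A); first by rewrite -A0 (valP A) in n0.
by exists p; apply/eqP; rewrite -semiarc_ofE.
Qed.

(** The default value is only taken outside of the diagram. *)
Definition color_at f (p : nat * nat) : X :=
  if insub p is Some q then f (semiarc_of q) else cone X.

Lemma color_at_val f p : color_at f (val p) = f (semiarc_of p).
Proof. by rewrite /color_at valK. Qed.

Lemma point_of (p : nat * nat) :
  p \in upper_points 1 D -> exists q : point D, p = val q.
Proof. by rewrite -mem_points => pD; exists (SeqSub pD). Qed.

Lemma diagram_composable : composable [::] D [::].
Proof. by case/andP: (diagramP D). Qed.

Lemma color_at_strands f e :
  e \in strands 0 D -> color_at f e.1 = color_at f e.2.
Proof.
case: e => a b eD; have := strand_ends diagram_composable eD.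
rewrite /= => /andP[/point_of[p ep] /point_of[q eq]].
rewrite ep eq !color_at_val; congr (f _); apply/eqP.
rewrite -semiarc_ofE mem_semiarc_of joined_sym; apply: connect1.
by rewrite /joined /= -ep -eq eD orbT.
Qed.

Lemma on_semiarcE p A : on_semiarc (val p) A = (A == semiarc_of p).
Proof.
rewrite -semiarc_ofE; apply/existsP/idP.
  by case=> q /andP[qA /eqP/val_inj <-].
move=> pA.
by exists p; rewrite pA eqxx.
Qed.

(** The quantifiers over semiarcs in the definition of a coloring have one
   instance each as soon as the points of the crossing are on the diagram. *)
Lemma crossing_ruleE f c :
  all (mem (upper_points 1 D)) (crossing_points c) ->
  crossing_rule f c = rule (color_at f) c.
Proof.
case: c => s ui uo oi oo /= /and5P[].
do 4 (case/point_of => ? ->); move=> _.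
rewrite /crossing_rule /rule /= !color_at_val.
apply/forallP/idP => [h | h ui'].
  move: h => /(_ _)/forallP/(_ _)/forallP/(_ _)/forallP/(_ _)/implyP.
  by apply; rewrite !on_semiarcE !eqxx.
apply/forallP => uo'; apply/forallP => oi'; apply/forallP => oo'.
by apply/implyP; rewrite !on_semiarcE => /and4P[/eqP-> /eqP-> /eqP-> /eqP->].
Qed.

Definition trace f := rows (color_at f) 1 D.

Lemma is_coloringE f : is_coloring f = runs D [::] (trace f).
Proof.
have /(respects_runs (color_at f) 0) /= <- := diagram_composable.
rewrite /respects; set constant := all _ (strands 0 D).
have -> /= : constant.
  by apply/allP => e eD; apply/eqP; apply: color_at_strands.
apply: eq_all_under (all_crossing_ends 0 diagram_composable) _ => c.
exact: crossing_ruleE.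
Qed.

Lemma image_entries f : [set f A | A : semiarc D] = entries (flatten (trace f)).
Proof.
apply/setP => x; rewrite inE flatten_rows.
apply/imsetP/mapP => [[A _ ->] | [p /point_of[q ->] ->]].
  have [p ->] := semiarc_ex A; exists (val p); rewrite ?color_at_val //.
  by rewrite -mem_points; apply: valP.
by rewrite color_at_val; exists (semiarc_of q).
Qed.

Lemma trace_inj : injective trace.
Proof.
move=> f g /eq_rows e; apply/ffunP => A; have [p ->] := semiarc_ex A.
by rewrite -!color_at_val e // -mem_points; apply: valP.
Qed.

(** Rows that satisfy the relations of all slices define a function on points
   that is constant along the strands, hence a function on semiarcs. *)
Lemma trace_onto T : runs D [::] T -> exists f, trace f = T.
Proof.
move=> rT.
pose g (p : nat * nat) := nth (cone X) (nth [::] ([::] :: T) p.1) p.2.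
have eg : rows g 1 D = T by apply: rows_nth rT _.
have : respects g 0 D by rewrite (respects_runs g 0 diagram_composable) eg.
case/andP => /allP str _.
have gc p q : connect (@joined D) p q -> g (val p) = g (val q).
  case/connectP => s; elim: s p => [|r s IH] p /=; first by move=> _ ->.
  case/andP => /orP[] /str /eqP /= e rs eq; last by rewrite -e; apply: IH.
  by rewrite e; apply: IH.
exists [ffun A : semiarc D =>
          if [pick p in val A] is Some p then g (val p) else cone X].
rewrite -{}eg; apply/eq_rows => _ /point_of[p ->]; rewrite color_at_val ffunE.
case: pickP => [q | /(_ p)]; rewrite mem_semiarc_of ?connect0 //.
by move/gc.
Qed.
End Semiarcs.

(** * Invariance *)

Section Invariance.
Variables (X : finSkewBrace) (V : nmodType) (F : {set X} -> V).

Lemma coloring_sumE (D : diagram) :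
  (\sum_(f in colorings X D) F (image_closure f))%R = state_sum F D [::] set0.
Proof.
rewrite -big_enum /=.
transitivity (\sum_(T <- [seq trace f | f <- enum (colorings X D)])
                F (biq_closure (entries (flatten T))))%R.
  rewrite big_map; apply: eq_bigr => f _.
  by rewrite /image_closure image_entries.
rewrite /state_sum; under [RHS]eq_bigr do rewrite set0U.
apply/perm_big/uniq_perm.
- by rewrite map_inj_uniq ?enum_uniq //; apply: trace_inj.
- exact: traces_uniq.
move=> T; rewrite mem_traces; apply/mapP/idP => [[f + ->] | rT].
  by rewrite mem_enum inE is_coloringE.
have [f eT] := trace_onto rT; exists f => //.
by rewrite mem_enum inE is_coloringE eT.
Qed.

Lemma coloring_sum_invariant (D D' : diagram) :
  same_link D D' ->
  (\sum_(f in colorings X D) F (image_closure f) =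
   \sum_(f in colorings X D') F (image_closure f))%R.
Proof.
rewrite !coloring_sumE; elim=> {D D'} //=.
- by move=> D D'; apply: state_sum_move.
- by move=> D1 D2 D3 _ -> _ ->.
Qed.
End Invariance.

Theorem theorem3 (X : finSkewBrace) (D D' : diagram) (h : same_link D D') :
  PhiSB X D = PhiSB X D' /\ PhiI X D = PhiI X D'.
Proof.
split; first exact: (coloring_sum_invariant (fun S : {set X} =>
  'X_ord0 ^+ #|circ_gen S| * 'X_ord_max ^+ #|star_gen S|)%R h).
exact: (coloring_sum_invariant (fun S : {set X} => 'X ^+ #|ideal_gen S|)%R h).
Qed.
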